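(* Let $\mu$ be a probability measure on $\mathbb{R}$, and let $f:\mathbb{R}\to\mathbb{R}$ be bi-Lipschitz: there are $m,M>0$ such that for all $x,y\in\mathbb{R}$, $$m|x-y|\le|f(x)-f(y)|\le M|x-y|.$$ Let $\eta$ be the push-forward of $\mu$ by $f$. Then $\delta_{c}(\mu)=\delta_{c}(\eta)$.
   Context: For $t>0$, let $\nu_t$ be the centered Gaussian law on $\mathbb{R}$ with variance $t^2$. For a probability measure $\rho$ on $\mathbb{R}$, let $\rho_t=\rho*\nu_t$. Write $H(p(x)\,dx)=\int p\log p\,dx$, and define $$\delta_c(\rho)=1-\liminf_{t\to0}\frac{H(\rho_t)}{|\log t|}.$$ *)

(* Defs.v *)
From HB Require Import structures.
From mathcomp Require Import all_boot all_order all_algebra.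
From mathcomp Require Import all_classical all_reals all_analysis.
Set Implicit Arguments. Unset Strict Implicit. Unset Printing Implicit Defensive.
Import Order.TTheory GRing.Theory Num.Theory.
Import numFieldNormedType.Exports.
Local Open Scope classical_set_scope.
Local Open Scope ring_scope.

Section dc.
Context {R : realType}.

(* density of rho_t = rho * nu_t, nu_t = centered Gaussian with standard
   deviation t (variance t^2):  p_t(x) = \int phi_t(x - y) d rho(y) *)
Definition gauss_conv_dens (rho : {measure set R -> \bar R}) (t x : R) : R :=
  fine (\int[rho]_y (normal_pdf y t x)%:E)%E.

Definition gauss_entropy (rho : {measure set R -> \bar R}) (t : R) : \bar R :=
  (\int[lebesgue_measure]_x
     (gauss_conv_dens rho t x * ln (gauss_conv_dens rho t x))%:E)%E.

Definition delta_c (rho : {measure set R -> \bar R}) : \bar R :=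
  (1 - limf_einf (fun t : R => gauss_entropy rho t * (`|ln t|)^-1%:E) (0^'+))%E.

End dc.

(* Main.v *)
Require Import Defs.
From HB Require Import structures.
From mathcomp Require Import all_boot all_order all_algebra.
From mathcomp Require Import all_classical all_reals all_analysis.
From mathcomp Require Import measurable_realfun ring lra.
Import Order.TTheory GRing.Theory Num.Theory.
Import numFieldNormedType.Exports.
Local Open Scope classical_set_scope.
Local Open Scope ring_scope.

(* Both entropies differ by at most a constant, uniformly in t > 0.  Let X and
   Y be random variables on the same space with |X w - X w'| <= L |Y w - Y w'|,
   L >= 1, let p_t and q_t be the densities of their Gaussian smoothings, and
   put s = 2 L t.  From (a + b)^2 <= 2 a^2 + 2 b^2 one gets, for all x, u, w,
     p_s(x) >= (2 L)^-1 exp (- ((x - X w)^2 + (u - Y w)^2) / 2 t^2) q_t(u).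
   Averaging the logarithm over x ~ N(X w, t^2), u ~ N(Y w, t^2) and w bounds
   H(q_t) by \int p_t log p_s + C(L), and \int p_t log p_s <= H(p_t) + 1 by
   Gibbs' inequality.  Apply this to (X, Y) = (f, id) and to (id, f).
   To use Tonelli with entropies that may be -oo, log-densities are replaced by
   their nonnegative distance to the logarithm of the peak of N(0, t^2). *)

(** * Gaussian densities and averages against them *)

Section normal_pdf_complements.
Context {R : realType}.
Implicit Types (m t x a : R).

Lemma normal_pdf_gt0 m t x : 0 < t -> 0 < normal_pdf m t x.
Proof.
move=> t0; rewrite normal_pdfE ?gt_eqF// mulr_gt0 ?expR_gt0//.
by rewrite normal_peak_gt0// gt_eqF.
Qed.

Lemma normal_peakM a t : 0 < a -> normal_peak (a * t) = a^-1 * normal_peak t.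
Proof.
move=> a0; rewrite /normal_peak -invfM; congr _^-1.
rewrite exprMn -mulrA -mulrnAr sqrtrM ?sqr_ge0// sqrtr_sqr gtr0_norm//.
Qed.

(** Put v = (x - m)^2 / 2 t^2. Doubling the width halves the peak and turns exp(-v) into exp(-v/4),
    so the claim reduces to v <= 2 exp(3v/4), which follows from exp y >= 1 + y. Since a density has
    mass one, this bounds the Gaussian mean of v by 4 without computing a variance. *)
Lemma normal_pdf_sqr_le m t x : 0 < t ->
  normal_pdf m t x * ((x - m) ^+ 2 / (t ^+ 2 *+ 2)) <=
  4 * normal_pdf m (2 * t) x.
Proof.
move=> t0; have t20 : 2 * t != 0 by rewrite mulf_neq0// gt_eqF.
rewrite !normal_pdfE ?gt_eqF ?mulr_gt0// /normal_fun normal_peakM//.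
set v := (x - m) ^+ 2 / (t ^+ 2 *+ 2).
have -> : - (x - m) ^+ 2 / (t ^+ 2 *+ 2) = - v by rewrite mulNr.
have -> : - (x - m) ^+ 2 / ((2 * t) ^+ 2 *+ 2) = - v + v * (3 / 4).
  by rewrite /v; field; rewrite gt_eqF.
have v0 : 0 <= v by rewrite divr_ge0 ?sqr_ge0// mulrn_wge0// sqr_ge0.
rewrite expRD -mulrA [leRHS](_ : _ = normal_peak t * (expR (- v) * (2 * expR (v * (3 / 4))))); last first.
  by field.
rewrite ler_wpM2l ?normal_peak_ge0// ler_wpM2l ?expR_ge0//.
have := expR_ge1Dx (v * (3 / 4)); lra.
Qed.

Lemma measurable_normal_pdf_pair d (T : measurableType d) (X : T -> R) t :
  measurable_fun setT X -> 0 < t ->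
  measurable_fun setT (fun z : T * R => normal_pdf (X z.1) t z.2).
Proof.
move=> mX t0.
rewrite (_ : (fun _ => _) = (fun z : T * R => normal_peak t *
    expR (- (z.2 - X z.1) ^+ 2 / (t ^+ 2 *+ 2)))); last first.
  by apply/funext => z; rewrite normal_pdfE ?gt_eqF.
apply: measurable_funM => //; apply: measurableT_comp => //.
apply: measurable_funM => //; apply: measurableT_comp => //.
apply: measurable_funX; apply: measurable_funB => //.
exact: measurableT_comp mX measurable_fst.
Qed.

(** The hypothesis is integrated against N(m, t^2): the quadratic term costs at most 4 by
    [normal_pdf_sqr_le], and the constant costs K. Nonnegativity lets either side be infinite. *)
Lemma normal_average_le m t (F G : R -> \bar R) (K : R) : 0 < t -> 0 <= K ->
  measurable_fun setT F -> measurable_fun setT G ->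
  (forall x, 0 <= F x)%E -> (forall x, 0 <= G x)%E ->
  (forall x, F x <= G x + ((x - m) ^+ 2 / (t ^+ 2 *+ 2) + K)%:E)%E ->
  (\int[lebesgue_measure]_x ((normal_pdf m t x)%:E * F x) <=
   \int[lebesgue_measure]_x ((normal_pdf m t x)%:E * G x) + (4 + K)%:E)%E.
Proof.
move=> t0 K0 mF mG F0 G0 FG.
have mpdf (s : R) : measurable_fun [set: R] (fun x => (normal_pdf m s x)%:E).
  by apply/measurable_EFinP; exact: measurable_normal_pdf.
have pdf0 (s x : R) : (0 <= (normal_pdf m s x)%:E)%E.
  by rewrite lee_fin normal_pdf_ge0.
have E : (\int[lebesgue_measure]_x (4 * normal_pdf m (2 * t) x)%:E +
   \int[lebesgue_measure]_x (K * normal_pdf m t x)%:E = (4 + K)%:E)%E.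
  under eq_integral do rewrite EFinM.
  rewrite ge0_integralZl//; [|exact: mpdf].
  under [X in (_ + X)%E]eq_integral do rewrite EFinM.
  rewrite ge0_integralZl//; [|exact: mpdf].
  by rewrite !integral_normal_pdf !mule1.
have mM (k s : R) : measurable_fun [set: R] (fun x => (k * normal_pdf m s x)%:E).
  by apply/measurable_EFinP/measurable_funM => //; exact: measurable_normal_pdf.
have M0 (k s x : R) : 0 <= k -> (0 <= (k * normal_pdf m s x)%:E)%E.
  by move=> k0; rewrite lee_fin mulr_ge0// normal_pdf_ge0.
have mD := emeasurable_funD (mM 4 (2 * t)) (mM K t).
have mphi (H : R -> \bar R) : measurable_fun setT H ->
    measurable_fun setT (fun x => (normal_pdf m t x)%:E * H x)%E.
  by move=> mH; exact: emeasurable_funM (mpdf t) mH.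
have phi0 (H : R -> \bar R) : (forall x, 0 <= H x)%E ->
    forall x, setT x -> (0 <= (normal_pdf m t x)%:E * H x)%E.
  by move=> H0 x _; exact: mule_ge0.
have {E} <- : (\int[lebesgue_measure]_x ((normal_pdf m t x)%:E * G x +
    ((4 * normal_pdf m (2 * t) x)%:E + (K * normal_pdf m t x)%:E)) =
    \int[lebesgue_measure]_x ((normal_pdf m t x)%:E * G x) + (4 + K)%:E)%E.
  rewrite ge0_integralD//; first rewrite ge0_integralD ?E//.
  - by move=> x _; exact: M0.
  - exact: mM.
  - by move=> x _; exact: M0.
  - exact: mM.
  - exact: phi0.
  - exact: mphi.
  - by move=> x _; rewrite adde_ge0 ?M0.
apply: ge0_le_integral => //; [exact: phi0|exact: mphi| |].
- by apply: emeasurable_funD; [exact: mphi|exact: mD].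
- move=> x _; apply: (le_trans (lee_wpmul2l (pdf0 t x) (FG x))).
  rewrite ge0_muleDr//; last first.
    by rewrite lee_fin addr_ge0// divr_ge0 ?sqr_ge0// mulrn_wge0// sqr_ge0.
  rewrite leeD2l// -EFinM -EFinD lee_fin mulrDr lerD ?normal_pdf_sqr_le//.
  by rewrite mulrC.
Qed.

Lemma normal_average_cst (m t : R) (c : \bar R) : (0 <= c)%E ->
  (\int[lebesgue_measure]_x ((normal_pdf m t x)%:E * c) = c)%E.
Proof.
move=> c0; rewrite ge0_integralZr//.
- by rewrite integral_normal_pdf mul1e.
- by apply/measurable_EFinP; exact: measurable_normal_pdf.
- by move=> x _; rewrite lee_fin normal_pdf_ge0.
Qed.

End normal_pdf_complements.

(** * Integrals equal to -oo, and lower limits scaled by the logarithm *)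

Lemma ge0_integrableB d (T : measurableType d) (R : realType)
    (mu : {measure set T -> \bar R}) (f g : T -> R) :
  mu.-integrable setT (EFin \o f) -> measurable_fun setT g ->
  (forall x, 0 <= g x) ->
  (\int[mu]_x (f x - g x)%:E = \int[mu]_x (f x)%:E - \int[mu]_x (g x)%:E)%E.
Proof.
move=> fi mg g0.
have mf : measurable_fun setT f by move/integrableP : fi => -[/measurable_EFinP].
have gE : (\int[mu]_x `|(EFin \o g) x| = \int[mu]_x (g x)%:E)%E.
  by apply: eq_integral => x _; rewrite gee0_abs// lee_fin.
have [goo|] := ltP (\int[mu]_x (g x)%:E)%E +oo%E.
  rewrite -integralB//; apply/integrableP; split; last by rewrite gE.
  exact/measurable_EFinP.
(* When [g] has infinite integral, the positive part of [f - g] is still dominated by [|f|]. Its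
   negative part must have infinite integral, since otherwise [g = f - (f - g)] would be
   integrable. *)
rewrite leye_eq => /eqP goo.
have mfg : measurable_fun setT (fun x => (f x - g x)%:E).
  by apply/measurable_EFinP; exact: measurable_funB.
rewrite goo addeNy.
have fgp : ((\int[mu]_x ((fun x => (f x - g x)%:E)^\+ x)) < +oo)%E.
  have /integrableP[_] := fi; apply: le_lt_trans.
  apply: ge0_le_integral => //.
  - exact: measurable_funepos.
  - exact/measurableT_comp/measurable_EFinP.
  - move=> x _; rewrite funeposE /= ge_max; apply/andP; split => //.
    by rewrite lee_fin (le_trans _ (ler_norm _))// gerBl.
rewrite integralE.
have [fgn|] := ltP (\int[mu]_x ((fun x => (f x - g x)%:E)^\- x))%E +oo%E.
  have fgi : mu.-integrable setT (EFin \o (fun x => f x - g x)).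
    apply/integrableP; split => //.
    rewrite (eq_integral (fun x => (fun x => (f x - g x)%:E)^\+ x +
      (fun x => (f x - g x)%:E)^\- x)%E); last first.
      by move=> x _; rewrite -[RHS]/((_ \+ _) x)%E -fune_abse.
    rewrite ge0_integralD//; [|exact: measurable_funepos|exact: measurable_funeneg].
    by rewrite lte_add_pinfty.
  have : mu.-integrable setT (EFin \o g).
    rewrite (_ : EFin \o g =
      (fun x => (f x)%:E - (f x - g x)%:E)%E).
      exact: integrableB.
    by apply/funext => x /=; rewrite -EFinB subKr.
  by move=> /integrableP[_]; rewrite gE goo.
rewrite leye_eq => /eqP ->.
by rewrite addeNy.
Qed.

(** An additive constant disappears in the limit because C / |ln t| tends to 0 with t. *)
Lemma limf_einf_div_ln_le (R : realType) (u v : R -> \bar R) (C : R) :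
  (forall t, 0 < t -> (u t <= v t + C%:E)%E) ->
  (limf_einf (fun t => u t * (`|ln t|)^-1%:E) (0^'+) <=
   limf_einf (fun t => v t * (`|ln t|)^-1%:E) (0^'+))%E.
Proof.
move=> uv; apply/lee_addgt0Pr => e e0.
rewrite limf_einfE; apply: ge_ereal_sup => _ [/= V FV <-].
rewrite -leeBlDr// limf_einfE.
(* Any [V] competing in the lower limit of [u] is shrunk to a [W] on which the error term is at most
   [e]; [W] then competes in the lower limit of [v]. *)
pose W := V `&` [set t : R | 0 < t /\ C * (`|ln t|)^-1 <= e].
have FW : (0^'+) W.
  apply: filterI => //; near=> t; split=> //.
  (* With [|C|] the bound also forces [ln t < 0], and it works for either sign of [C]. *)
  have lt : ln t < - (`|C| / e).
    by near: t; move/cvgrNyPlt : (@lnNy R); exact.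
  have l0 : 0 < `|ln t|.
    rewrite normr_gt0 lt_eqF// (lt_le_trans lt)// oppr_le0 divr_ge0//.
    exact: ltW.
  rewrite ler_pdivrMr// mulrC -ler_pdivrMr//.
  rewrite (le_trans (ler_wpM2r _ (ler_norm C))) ?invr_ge0 ?(ltW e0)//.
  by rewrite -[`|ln t|]normrN (le_trans _ (ler_norm _))// lerNr ltW.
apply: (@le_trans _ _ (ereal_inf [set (v t * (`|ln t|)^-1%:E)%E | t in W])); last first.
  by apply: ereal_sup_ubound; exists W.
apply: le_ereal_inf_tmp => _ [/= t [Vt [t0 Ct]] <-].
rewrite EFinN leeBlDr//.
apply: (@le_trans _ _ (u t * (`|ln t|)^-1%:E)%E).
  by apply: ereal_inf_lbound; exists t.
apply: (@le_trans _ _ ((v t + C%:E) * (`|ln t|)^-1%:E)%E).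
  by apply: lee_wpmul2r; [rewrite lee_fin invr_ge0|exact: uv].
rewrite muleDl//; first by rewrite leeD2l// -EFinM lee_fin.
by rewrite fin_num_adde_defl.
Unshelve. all: by end_near. Qed.

(** * Densities of Gaussian smoothings of random variables *)

Definition smooth_dens {d} {T : measurableType d} {R : realType}
    (P : {measure set T -> \bar R}) (X : T -> R) (t x : R) : R :=
  fine (\int[P]_w (normal_pdf (X w) t x)%:E)%E.

Section smooth_dens.
Context {d} {T : measurableType d} {R : realType} (P : probability T R).
Variables (X : T -> R).
Hypothesis mX : measurable_fun setT X.
Implicit Types (t x : R).

Let measurable_pdf_w t x : 0 < t ->
  measurable_fun setT (fun w => (normal_pdf (X w) t x)%:E).
Proof.
move=> t0; apply/measurable_EFinP.
exact: (measurableT_comp (measurable_normal_pdf_pair _ _ _ _ mX t0)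
  (measurable_pair2 x)).
Qed.

Let pdf_ge0 t x w : (0 <= (normal_pdf (X w) t x)%:E)%E.
Proof. by rewrite lee_fin normal_pdf_ge0. Qed.

Let smooth_densE_le t x : 0 < t ->
  (\int[P]_w (normal_pdf (X w) t x)%:E <= (normal_peak t)%:E)%E.
Proof.
move=> t0; rewrite -[leRHS]mule1 -(probability_setT P) -integral_cst//.
apply: ge0_le_integral => //; first exact: measurable_pdf_w.
by move=> w _; rewrite lee_fin normal_pdf_ub// gt_eqF.
Qed.

(** The kernel is bounded by its peak and [P] has mass one, so the integral is finite and [fine]
    loses nothing. *)
Lemma smooth_densE t x : 0 < t ->
  (smooth_dens P X t x)%:E = (\int[P]_w (normal_pdf (X w) t x)%:E)%E.
Proof.
move=> t0; rewrite fineK// ge0_fin_numE; last exact: integral_ge0.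
exact: le_lt_trans (smooth_densE_le _ _ t0) (ltry _).
Qed.

Lemma smooth_dens_ub t x : 0 < t -> smooth_dens P X t x <= normal_peak t.
Proof. by move=> t0; rewrite -lee_fin smooth_densE// smooth_densE_le. Qed.

(** The kernel is positive at every point, so a zero integral would make the whole space negligible,
    against [P setT = 1]. Positivity keeps later logarithms away from the default value of [ln]. *)
Lemma smooth_dens_gt0 t x : 0 < t -> 0 < smooth_dens P X t x.
Proof.
move=> t0; rewrite lt_neqAle -lee_fin smooth_densE// integral_ge0 ?andbT//.
apply/eqP => p0.
have /(ae_eq_integral_abs P measurableT (measurable_pdf_w t x t0)) :
    (\int[P]_w `|(normal_pdf (X w) t x)%:E| = 0)%E.
  transitivity (smooth_dens P X t x)%:E; last by rewrite -p0.
  by rewrite smooth_densE//; apply: eq_integral => w _; rewrite gee0_abs.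
move=> [N [mN N0 sN]].
have NT : N = setT.
  apply/seteqP; split=> // w _; apply: sN => /= /(_ Logic.I) [].
  by apply/eqP; rewrite gt_eqF// normal_pdf_gt0.
have := probability_setT P; rewrite -NT => P1.
by have := etrans (esym N0) P1 => /esym/eqP; rewrite onee_eq0.
Qed.

Let measurable_pdf_pair t : 0 < t ->
  measurable_fun setT (fun z : T * R => (normal_pdf (X z.1) t z.2)%:E).
Proof.
by move=> t0; apply/measurable_EFinP; exact: measurable_normal_pdf_pair.
Qed.

Lemma measurable_smooth_dens t : 0 < t ->
  measurable_fun setT (smooth_dens P X t).
Proof.
move=> t0; apply/measurable_EFinP.
rewrite (_ : _ \o _ = fubini_G P (fun z : T * R => (normal_pdf (X z.1) t z.2)%:E)).
  apply: measurable_fun_fubini_tonelli_G; first exact: measurable_pdf_pair.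
  by move=> z; exact: pdf_ge0.
by apply/funext => x; rewrite /= smooth_densE.
Qed.

Let measurable_pdfM t (F : R -> \bar R) : 0 < t -> measurable_fun setT F ->
  measurable_fun setT (fun z : T * R => (normal_pdf (X z.1) t z.2)%:E * F z.2)%E.
Proof.
move=> t0 mF; apply: emeasurable_funM; first exact: measurable_pdf_pair.
exact: measurableT_comp mF measurable_snd.
Qed.

Lemma measurable_normal_average t (F : R -> \bar R) : 0 < t ->
  measurable_fun setT F -> (forall x, 0 <= F x)%E ->
  measurable_fun setT
    (fun w => \int[lebesgue_measure]_x ((normal_pdf (X w) t x)%:E * F x))%E.
Proof.
move=> t0 mF F0.
apply: (measurable_fun_fubini_tonelli_F (m2 := lebesgue_measure)
  (fun z : T * R => (normal_pdf (X z.1) t z.2)%:E * F z.2)%E).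
  exact: measurable_pdfM.
by move=> z; rewrite mule_ge0.
Qed.

(** Tonelli: averaging under the smoothed law means drawing [w] first, then x ~ N(X w, t^2). This
    lets estimates be proved for one [w] at a time. *)
Lemma integral_smooth_densM t (F : R -> \bar R) : 0 < t ->
  measurable_fun setT F -> (forall x, 0 <= F x)%E ->
  (\int[lebesgue_measure]_x ((smooth_dens P X t x)%:E * F x) =
   \int[P]_w \int[lebesgue_measure]_x ((normal_pdf (X w) t x)%:E * F x))%E.
Proof.
move=> t0 mF F0.
rewrite (fubini_tonelli (m2 := lebesgue_measure)
  (fun z : T * R => (normal_pdf (X z.1) t z.2)%:E * F z.2)%E); first last.
- by move=> z; rewrite mule_ge0.
- exact: measurable_pdfM.
apply: eq_integral => x _ /=.
rewrite ge0_integralZr//; last exact: measurable_pdf_w.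
by rewrite smooth_densE.
Qed.

Lemma integral_smooth_dens t : 0 < t ->
  (\int[lebesgue_measure]_x (smooth_dens P X t x)%:E = 1)%E.
Proof.
move=> t0.
under eq_integral do rewrite -[_%:E]mule1.
rewrite (integral_smooth_densM _ (cst 1%E))//.
under eq_integral do (under eq_integral do rewrite mule1;
  rewrite integral_normal_pdf).
by rewrite integral_cst// mul1e; exact: probability_setT.
Qed.

End smooth_dens.

(** * Entropy expressed through a nonnegative logarithmic loss *)

Section entropy_loss.
Context {d} {T : measurableType d} {R : realType} (P : probability T R).
Implicit Types (X : T -> R) (t s x : R).

(* [s] is the smoothing width; [t] only sets the reference level. *)
Definition log_loss X t s x : R :=
  ln (normal_peak t) - ln (smooth_dens P X s x).

Lemma measurable_log_loss X t s : measurable_fun setT X -> 0 < s ->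
  measurable_fun setT (log_loss X t s).
Proof.
move=> mX s0; apply: measurable_funB => //.
apply: measurableT_comp; first exact: measurable_ln.
exact: measurable_smooth_dens.
Qed.

(** A density smoothed at width [s] stays below the peak of N(0, s^2), which is at most the peak of
    N(0, t^2) when [t <= s]. *)
Lemma log_loss_ge0 X t s x : measurable_fun setT X -> 0 < t -> t <= s ->
  0 <= log_loss X t s x.
Proof.
move=> mX t0 ts; have s0 := lt_le_trans t0 ts.
rewrite subr_ge0 ler_ln ?posrE ?smooth_dens_gt0 ?normal_peak_gt0 ?gt_eqF//.
apply: (le_trans (smooth_dens_ub _ _ mX _ _ s0)).
have -> : s = (s / t) * t by rewrite divfK// gt_eqF.
rewrite normal_peakM ?divr_gt0// ler_piMl ?normal_peak_ge0//.
by rewrite invf_div ler_pdivrMr// mul1r.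
Qed.

(** As the density p has mass one, p ln p = p b - p (b - ln p) can be integrated termwise with b the
    log-peak. The second integral may be +oo, and the entropy is then -oo. *)
Lemma smooth_entropyE X t : measurable_fun setT X -> 0 < t ->
  (\int[lebesgue_measure]_x
     (smooth_dens P X t x * ln (smooth_dens P X t x))%:E =
   (ln (normal_peak t))%:E -
   \int[lebesgue_measure]_x ((smooth_dens P X t x)%:E * (log_loss X t t x)%:E))%E.
Proof.
move=> mX t0; set p := smooth_dens P X t; set b := ln (normal_peak t).
have mp : measurable_fun setT p by exact: measurable_smooth_dens.
have p0 x : 0 < p x by exact: smooth_dens_gt0.
have ip : lebesgue_measure.-integrable setT (EFin \o p).
  apply/integrableP; split; first exact/measurable_EFinP.
  under eq_integral do rewrite gee0_abs ?lee_fin ?(ltW (p0 _))//.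
  by rewrite integral_smooth_dens// ltry.
transitivity (\int[lebesgue_measure]_x (b * p x - p x * log_loss X t t x)%:E)%E.
  by apply: eq_integral => x _; congr EFin; rewrite /log_loss -/b -/p; ring.
rewrite ge0_integrableB.
- congr (_ - _)%E.
  under eq_integral do rewrite EFinM.
  by rewrite integralZl// integral_smooth_dens// mule1.
- have := integrableZl measurableT b ip; congr (_.-integrable _ _).
- by apply: measurable_funM => //; exact: measurable_log_loss.
- by move=> x; rewrite mulr_ge0 ?log_loss_ge0// ltW.
Qed.

Lemma integral_log_loss_ge0 X t : measurable_fun setT X -> 0 < t ->
  (0 <= \int[lebesgue_measure]_x
     ((smooth_dens P X t x)%:E * (log_loss X t t x)%:E))%E.
Proof.
move=> mX t0; apply: integral_ge0 => x _.
by rewrite -EFinM lee_fin mulr_ge0 ?log_loss_ge0// ltW// smooth_dens_gt0.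
Qed.

(** With p and g the densities at widths [t] and [s], ln(1 + y) <= y at y = g/p - 1 gives p (ln g -
    ln p) <= g - p <= g. Dropping -p costs the constant 1, the mass of g, and keeps every integrand
    nonnegative. *)
Lemma gibbs_log_loss X t s : measurable_fun setT X -> 0 < t -> t <= s ->
  (\int[lebesgue_measure]_x ((smooth_dens P X t x)%:E * (log_loss X t t x)%:E) <=
   \int[lebesgue_measure]_x ((smooth_dens P X t x)%:E * (log_loss X t s x)%:E) + 1)%E.
Proof.
move=> mX t0 ts; have s0 := lt_le_trans t0 ts.
have p0 u x : 0 < u -> 0 < smooth_dens P X u x by exact: smooth_dens_gt0.
have mp u : 0 < u -> measurable_fun setT (fun x => (smooth_dens P X u x)%:E).
  by move=> u0; apply/measurable_EFinP; exact: measurable_smooth_dens.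
have mL u : 0 < u -> measurable_fun setT (fun x => (log_loss X t u x)%:E).
  by move=> u0; apply/measurable_EFinP; exact: measurable_log_loss.
have mpL u : 0 < u -> measurable_fun setT
    (fun x => (smooth_dens P X t x)%:E * (log_loss X t u x)%:E)%E.
  by move=> u0; apply: emeasurable_funM; [exact: mp|exact: mL].
have pL0 u x : t <= u -> (0 <= (smooth_dens P X t x)%:E * (log_loss X t u x)%:E)%E.
  by move=> tu; rewrite -EFinM lee_fin mulr_ge0 ?log_loss_ge0// ltW// p0.
rewrite -(integral_smooth_dens P X mX s s0) -ge0_integralD//; first last.
- exact: mp.
- by move=> x _; rewrite lee_fin ltW// p0.
- exact: mpL.
- by move=> x _; exact: pL0.
apply: ge0_le_integral => //.
- by move=> x _; exact: pL0.
- exact: mpL.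
- by apply: emeasurable_funD; [exact: mpL|exact: mp].
move=> x _; rewrite -!EFinM -EFinD lee_fin /log_loss.
have := p0 t x t0; have := p0 s x s0.
move: (smooth_dens P X t x) (smooth_dens P X s x) => p g g0 pp.
have : ln (1 + (g / p - 1)) <= g / p - 1.
  by apply: le_ln1Dx; rewrite ltrBDr addNr divr_gt0.
rewrite addrC subrK ln_div ?posrE// => /(ler_wpM2l (ltW pp)).
have -> : p * (g / p - 1) = g - p by field; rewrite gt_eqF.
lra.
Qed.

End entropy_loss.

(** Turns a comparison of losses into one of entropies when these may be infinite: y = +oo makes the
    left side -oo, and x = +oo forces y = +oo. *)
Lemma leeB_swap (R : realFieldType) (b c : R) (x y : \bar R) :
  (0 <= y -> 0 <= x -> x <= y + c%:E -> b%:E - y <= b%:E - x + c%:E)%E.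
Proof.
move: x y => [x| |] [y| |] //=; rewrite ?leNye// -!EFinD !lee_fin => _ _; lra.
Qed.

(** * Entropy comparison for two random variables on one space *)

Section comparison.
Context {d} {T : measurableType d} {R : realType} (P : probability T R).
Variables (X Y : T -> R) (L : R).
Hypotheses (mX : measurable_fun setT X) (mY : measurable_fun setT Y).
Hypotheses (L1 : 1 <= L)
  (XY : forall w w', `|X w - X w'| <= L * `|Y w - Y w'|).
Implicit Types (t x u : R).

Let L0 : 0 < L. Proof. exact: lt_le_trans L1. Qed.

Let L2 : 1 <= 2 * L. Proof. by have := L1; lra. Qed.

Let XY2 w w' : (X w - X w') ^+ 2 <= L ^+ 2 * (Y w - Y w') ^+ 2.
Proof.
rewrite -[leLHS]real_normK ?num_real// -[X in _ * X]real_normK ?num_real//.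
by rewrite -exprMn lerXn2r ?nnegrE ?mulr_ge0// ltW.
Qed.

(** Here (x - X w')^2 <= 2 (x - X w)^2 + 2 L^2 (Y w - Y w')^2, and (Y w - Y w')^2 <= 2 (u - Y w)^2 +
    2 (u - Y w')^2. Dividing by 4 L^2, the effect of the width 2 L t, leaves all three squares with
    coefficients at most 1; the wider peak gives the factor (2 L)^-1. *)
Lemma normal_pdf_harnack t x u w w' : 0 < t ->
  (2 * L)^-1 * expR (- ((x - X w) ^+ 2 / (t ^+ 2 *+ 2) +
                        (u - Y w) ^+ 2 / (t ^+ 2 *+ 2))) *
    normal_pdf (Y w') t u <= normal_pdf (X w') (2 * L * t) x.
Proof.
move=> t0; have s0 : 0 < 2 * L * t by rewrite !mulr_gt0.
rewrite !normal_pdfE ?gt_eqF// normal_peakM ?mulr_gt0// /normal_fun.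
rewrite mulrACA -expRD ler_wpM2l ?mulr_ge0 ?normal_peak_ge0 ?invr_ge0 ?mulr_ge0 ?(ltW L0)//.
rewrite ler_expR -mulNr -!mulrDl.
have -> : - (x - X w') ^+ 2 / ((2 * L * t) ^+ 2 *+ 2) =
    (- (x - X w') ^+ 2 / (4 * L ^+ 2)) / (t ^+ 2 *+ 2).
  by field; rewrite !gt_eqF.
rewrite -mulNr -mulrDl ler_wpM2r ?invr_ge0 ?mulrn_wge0 ?sqr_ge0//.
rewrite ler_pdivlMr ?mulr_gt0 ?exprn_gt0//.
have LL : 1 <= L ^+ 2 by rewrite exprn_ege1.
have := XY2 w w'.
set a := x - X w; set b := X w - X w'; set e := u - Y w; set k := Y w - Y w'.
have -> : x - X w' = a + b by rewrite /a /b; ring.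
have -> : u - Y w' = e + k by rewrite /e /k; ring.
move: a b e k (L ^+ 2) LL => a b e k l LL bk.
(* These squares certify the inequality: (a - b)^2 = 2 a^2 + 2 b^2 - (a + b)^2 and, in [h4], (2 e +
   k)^2 = 2 e^2 + 2 (e + k)^2 - k^2. *)
have h1 := sqr_ge0 (a - b); have h2 := sqr_ge0 a.
have h3 : 0 <= (l - 1) * a ^+ 2 by rewrite mulr_ge0 ?subr_ge0.
have h4 : 0 <= l * (2 * e + k) ^+ 2 by rewrite mulr_ge0 ?sqr_ge0// (le_trans ler01).
nra.
Qed.

(** The prefactor is independent of [w'], so the bound between kernels integrates over [w'] with [w]
    kept as a free reference point. *)
Lemma smooth_dens_harnack t x u w : 0 < t ->
  (2 * L)^-1 * expR (- ((x - X w) ^+ 2 / (t ^+ 2 *+ 2) +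
                        (u - Y w) ^+ 2 / (t ^+ 2 *+ 2))) *
    smooth_dens P Y t u <= smooth_dens P X (2 * L * t) x.
Proof.
move=> t0; have s0 : 0 < 2 * L * t by rewrite !mulr_gt0.
rewrite -lee_fin EFinM !smooth_densE//.
have m (Z : T -> R) s y : measurable_fun setT Z -> 0 < s ->
    measurable_fun setT (fun w => (normal_pdf (Z w) s y)%:E).
  move=> mZ ?; apply/measurable_EFinP.
  exact: (measurableT_comp (measurable_normal_pdf_pair _ _ _ _ mZ _)
    (measurable_pair2 y)).
have c0 : 0 <= (2 * L)^-1 * expR (- ((x - X w) ^+ 2 / (t ^+ 2 *+ 2) +
                        (u - Y w) ^+ 2 / (t ^+ 2 *+ 2))).
  by rewrite mulr_ge0 ?expR_ge0// invr_ge0 mulr_ge0// ltW.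
rewrite -ge0_integralZl//; [|exact: m|by move=> *; rewrite lee_fin normal_pdf_ge0].
apply: ge0_le_integral => //.
- by move=> w' _; rewrite -EFinM lee_fin mulr_ge0// normal_pdf_ge0.
- by apply: measurable_funeM; exact: m.
- exact: m.
by move=> w' _; rewrite -EFinM lee_fin normal_pdf_harnack.
Qed.

(** Logarithm of the previous bound. Both losses are measured from the same peak, that of N(0, t^2),
    so the reference level cancels. *)
Lemma log_loss_harnack t x u w : 0 < t ->
  log_loss P X t (2 * L * t) x <= log_loss P Y t t u +
    ((u - Y w) ^+ 2 / (t ^+ 2 *+ 2) +
    ((x - X w) ^+ 2 / (t ^+ 2 *+ 2) + ln (2 * L))).
Proof.
move=> t0; have s0 : 0 < 2 * L * t by rewrite !mulr_gt0.
have := smooth_dens_harnack t x u w t0.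
have q0 := smooth_dens_gt0 P Y mY t u t0.
rewrite -ler_ln ?posrE ?mulr_gt0 ?expR_gt0 ?invr_gt0 ?mulr_gt0 ?smooth_dens_gt0//.
rewrite !lnM ?posrE ?mulr_gt0 ?expR_gt0 ?invr_gt0 ?mulr_gt0//.
rewrite lnV ?posrE ?mulr_gt0// expRK /log_loss.
rewrite lnM ?posrE//.
move: ((x - X w) ^+ 2 / _) ((u - Y w) ^+ 2 / _) (ln (smooth_dens P Y t u)).
move: (ln (smooth_dens P X _ x)) (ln (normal_peak t)) (ln L) => *; lra.
Qed.

(* For fixed [w], the hypothesis is averaged over x ~ N(X w, t^2), then over u ~ N(Y w, t^2). *)
Lemma integral_smooth_dens_le t (K : R) (F G : R -> \bar R) : 0 < t -> 0 <= K ->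
  measurable_fun setT F -> measurable_fun setT G ->
  (forall x, 0 <= F x)%E -> (forall u, 0 <= G u)%E ->
  (forall w x u, F x <= G u + ((u - Y w) ^+ 2 / (t ^+ 2 *+ 2) +
    ((x - X w) ^+ 2 / (t ^+ 2 *+ 2) + K))%:E)%E ->
  (\int[lebesgue_measure]_x ((smooth_dens P X t x)%:E * F x) <=
   \int[lebesgue_measure]_u ((smooth_dens P Y t u)%:E * G u) + (8 + K)%:E)%E.
Proof.
move=> t0 K0 mF mG F0 G0 FG.
have Q0 (z : R) : 0 <= z ^+ 2 / (t ^+ 2 *+ 2).
  by rewrite divr_ge0 ?sqr_ge0// mulrn_wge0// sqr_ge0.
rewrite (integral_smooth_densM P X mX t F t0 mF F0).
rewrite (integral_smooth_densM P Y mY t G t0 mG G0).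
have mA := measurable_normal_average X mX t F t0 mF F0.
have mB := measurable_normal_average Y mY t G t0 mG G0.
have avg0 (m : R) (H : R -> \bar R) : (forall x, 0 <= H x)%E ->
    (0 <= \int[lebesgue_measure]_x ((normal_pdf m t x)%:E * H x))%E.
  by move=> H0; apply: integral_ge0 => x _; rewrite mule_ge0// lee_fin normal_pdf_ge0.
(* With [u] frozen, [G u] is constant in [x] and the square in [u] joins the additive constant. *)
have AG w u : (\int[lebesgue_measure]_x ((normal_pdf (X w) t x)%:E * F x) <=
    G u + ((u - Y w) ^+ 2 / (t ^+ 2 *+ 2) + (4 + K))%:E)%E.
  have := normal_average_le (X w) t F (cst (G u))
    ((u - Y w) ^+ 2 / (t ^+ 2 *+ 2) + K) t0.
  rewrite normal_average_cst// addrCA; apply => //; [exact: addr_ge0| |].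
    by move=> x; exact: G0.
  move=> x; apply: (le_trans (FG w x u)); rewrite leeD2l// lee_fin.
  by rewrite addrCA.
(* Now the left side is constant in [u]. Each of the two averages costs 4, hence 8. *)
have AB w : (\int[lebesgue_measure]_x ((normal_pdf (X w) t x)%:E * F x) <=
    \int[lebesgue_measure]_u ((normal_pdf (Y w) t u)%:E * G u) + (8 + K)%:E)%E.
  have := normal_average_le (Y w) t
    (cst (\int[lebesgue_measure]_x ((normal_pdf (X w) t x)%:E * F x))%E) G (4 + K) t0.
  rewrite normal_average_cst; last exact: avg0.
  rewrite (_ : 4 + (4 + K) = 8 + K); last by ring.
  apply; [exact: addr_ge0|exact: measurable_cst|exact: mG| |exact: G0|].
    by move=> x; exact: avg0.
  by move=> x; exact: AG.
have K8 : (0 <= (8 + K)%:E)%E by rewrite lee_fin addr_ge0.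
have -> : (8 + K)%:E = (\int[P]_w (cst (8 + K)%:E w))%E.
  by rewrite integral_cst// [X in (_ * X)%E]probability_setT mule1.
rewrite -ge0_integralD//; [|by move=> w _; exact: avg0].
apply: ge0_le_integral => //; first by move=> w _; exact: avg0.
exact: emeasurable_funD.
Qed.

Lemma integral_log_loss_le t : 0 < t ->
  (\int[lebesgue_measure]_x
     ((smooth_dens P X t x)%:E * (log_loss P X t (2 * L * t) x)%:E) <=
   \int[lebesgue_measure]_u
     ((smooth_dens P Y t u)%:E * (log_loss P Y t t u)%:E) +
   (8 + ln (2 * L))%:E)%E.
Proof.
move=> t0; have s0 : 0 < 2 * L * t by rewrite !mulr_gt0.
have ts : t <= 2 * L * t by rewrite ler_peMl// ltW.
apply: integral_smooth_dens_le => //.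
- by rewrite ln_ge0.
- by apply/measurable_EFinP; exact: measurable_log_loss.
- by apply/measurable_EFinP; exact: measurable_log_loss.
- by move=> x; rewrite lee_fin log_loss_ge0.
- by move=> x; rewrite lee_fin log_loss_ge0.
- by move=> w x u; rewrite -EFinD lee_fin log_loss_harnack.
Qed.

(** Entropy is the common log-peak minus the mean loss, so bounding the loss of [X] by that of [Y]
    bounds the entropy of [Y] by that of [X]. The 9 is 8 from the two Gaussian averages plus 1 from
    Gibbs. *)
Lemma smooth_entropy_le t : 0 < t ->
  (\int[lebesgue_measure]_u
     (smooth_dens P Y t u * ln (smooth_dens P Y t u))%:E <=
   \int[lebesgue_measure]_x
     (smooth_dens P X t x * ln (smooth_dens P X t x))%:E +
   (9 + ln (2 * L))%:E)%E.
Proof.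
move=> t0; have ts : t <= 2 * L * t by rewrite ler_peMl// ltW.
rewrite [leLHS](smooth_entropyE P Y t mY t0).
rewrite [X in (_ <= X + _)%E](smooth_entropyE P X t mX t0).
have := le_trans (gibbs_log_loss P X t (2 * L * t) mX t0 ts)
  (leeD2r 1%E (integral_log_loss_le t t0)).
have := integral_log_loss_ge0 P X t mX t0.
have := integral_log_loss_ge0 P Y t mY t0.
rewrite -addeA -EFinD (_ : 8 + ln (2 * L) + 1 = 9 + ln (2 * L)); last by ring.
exact: leeB_swap.
Qed.

End comparison.

(** * Push-forward measures and invariance under bi-Lipschitz maps *)

Lemma gauss_entropy_pushforward (R : realType) (P Q : probability R R)
    (X : R -> R) (t : R) : measurable_fun setT X -> 0 < t ->
  (forall A : set R, measurable A -> Q A = P (X @^-1` A)) ->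
  gauss_entropy Q t = (\int[lebesgue_measure]_x
     (smooth_dens P X t x * ln (smooth_dens P X t x))%:E)%E.
Proof.
move=> mX t0 QP; apply: eq_integral => x _.
suff -> : gauss_conv_dens Q t x = smooth_dens P X t x by [].
congr fine; rewrite (eq_measure_integral (pushforward P X)); last first.
  by move=> A mA _; exact: QP.
rewrite (ge0_integral_pushforward mX)//.
- apply/measurable_EFinP.
  exact: (measurableT_comp (measurable_normal_pdf_pair _ _ id _
    (@measurable_id _ _ _) t0) (measurable_pair2 x)).
- by move=> y _; rewrite lee_fin normal_pdf_ge0.
Qed.

Theorem theorem5p1 (R : realType) (mu eta : probability R R) (f : R -> R)
  (m M : R) (hm : 0 < m) (hM : 0 < M)
  (hf : forall x y : R, m * `|x - y| <= `|f x - f y| <= M * `|x - y|)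
  (heta : forall A : set R, measurable A -> eta A = mu (f @^-1` A)) :
  delta_c mu = delta_c eta.
Proof.
have mf : measurable_fun setT f.
  apply: continuous_measurable_fun => x; apply/cvgrPdist_le => e e0.
  near=> y.
  have /andP[_ /le_trans] := hf x y; apply.
  rewrite mulrC -ler_pdivlMr//.
  near: y; apply: (@cvgr_dist_le _ _ _ (nbhs x) _ id x) => //.
  by rewrite divr_gt0.
have mid : measurable_fun setT (@id R) by [].
(* The comparison wants a constant at least 1, so [c] is enlarged to [1 + c]. *)
have Lip (X Y : R -> R) (c : R) : 0 < c -> (forall x y, `|X x - X y| <= c * `|Y x - Y y|) ->
    forall x y, `|X x - X y| <= (1 + c) * `|Y x - Y y|.
  move=> c0 h x y; apply: (le_trans (h x y)).
  by rewrite ler_wpM2r// lerDr.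
(* Both measures become laws on the single space carrying [mu]: [mu] is the law of [id] and [eta]
   that of [f]. *)
have Hmu (t : R) (t0 : 0 < t) := gauss_entropy_pushforward R mu mu id t mid t0
  (fun _ _ => erefl).
have Heta (t : R) (t0 : 0 < t) := gauss_entropy_pushforward R mu eta f t mf t0 heta.
have ge1 c : 0 < c -> 1 <= 1 + c :> R by move=> c0; rewrite lerDl ltW.
apply: (congr1 (fun l => 1 - l)%E); apply: le_anti; apply/andP; split.
- apply: (limf_einf_div_ln_le R (gauss_entropy mu) (gauss_entropy eta)
    (9 + ln (2 * (1 + M)))) => t t0.
  rewrite [leLHS](Hmu t t0) [X in (_ <= X + _)%E](Heta t t0).
  apply: (smooth_entropy_le mu f id (1 + M) mf mid (ge1 _ hM) _ t t0).
  by apply: (Lip f id M hM) => x y; have /andP[] := hf x y.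
(* The lower bound on [f] says that [id] is Lipschitz relative to [f], with constant [m^-1]. *)
- have mV0 : 0 < m^-1 by rewrite invr_gt0.
  apply: (limf_einf_div_ln_le R (gauss_entropy eta) (gauss_entropy mu)
    (9 + ln (2 * (1 + m^-1)))) => t t0.
  rewrite [leLHS](Heta t t0) [X in (_ <= X + _)%E](Hmu t t0).
  apply: (smooth_entropy_le mu id f (1 + m^-1) mid mf (ge1 _ mV0) _ t t0).
  apply: (Lip id f _ mV0) => x y.
  by rewrite mulrC ler_pdivlMr// mulrC; have /andP[] := hf x y.
Unshelve. all: by end_near. Qed.
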